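(* Let $A_0,\dots,A_n$ be formulas and let $\Gamma=\{\cdot;A_i\}_{0\le i\le n}$ be a set of hypotheses (stp-cs with empty context); write also $\Gamma$ for the underlying set of formulas $\{A_i\}_{0\le i\le n}$. Let $\Delta$ be a finite multiset of formulas and $\Sigma$ empty or a single formula. Then $\Gamma\vdash_{\mathcal{LE}_p}\Delta;\Sigma$ if and only if $\Gamma,\neg\Delta\vdash_{\mathcal{NE}_p}\Sigma$, where in case $\Sigma$ is empty the right-hand side is read as $\Gamma,\neg\Delta\vdash_{\mathcal{NE}_p}\bot$.
   Context: Formulas of the propositional ecumenical language are built from intuitionistic atoms $p_i$, classical atoms $p_c$ and the constant $\bot$ using the neutral connectives $\neg,\wedge$, the intuitionistic connectives $\to_i,\vee_i$ and the classical connectives $\to_c,\vee_c$. For a multiset $\Delta$ of formulas, $\neg\Delta$ is the multiset of the negations of its members. System $\mathcal{NE}_p$ (propositional fragment of Prawitz' ecumenical natural deduction): usual natural deduction derivations of formulas from assumptions, with rules: $\to_i$-int (from $B$ derived from assumption $[A]$, infer $A\to_i B$, discharging $A$); $\to_i$-elim (from $A\to_i B$ and $A$ infer $B$); $\vee_i$-int (from $A_j$ infer $A_1\vee_i A_2$); $\vee_i$-elim (from $A\vee_i B$, $C$ derived from $[A]$ and $C$ derived from $[B]$, infer $C$); $\to_c$-int (from $\bot$ derived from $[A,\neg B]$ infer $A\to_c B$); $\to_c$-elim (from $A\to_c B$, $A$, $\neg B$ infer $\bot$); $\vee_c$-int (from $\bot$ derived from $[\neg A,\neg B]$ infer $A\vee_c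 B$); $\vee_c$-elim (from $A\vee_c B$, $\neg A$, $\neg B$ infer $\bot$); $p_c$-int (from $\bot$ derived from $[\neg p_i]$ infer $p_c$); $p_c$-elim (from $p_c$, $\neg p_i$ infer $\bot$); $\wedge$-int, $\wedge$-elim$_j$ as usual; $\neg$-int (from $\bot$ derived from $[A]$ infer $\neg A$); $\neg$-elim (from $A$ and $\neg A$ infer $\bot$); $\bot$-elim (from $\bot$ infer any $A$). $\Gamma\vdash_{\mathcal{NE}_p}A$ means $A$ is derivable with undischarged assumptions in $\Gamma$. System $\mathcal{LE}_p$: a stoup with a context (stp-c) is an expression $\Delta;\Sigma$ where $\Delta$ (the context) is a finite multiset of formulas and $\Sigma$ (the stoup) is empty (written $\cdot$) or a single formula. Derivations are trees of stp-cs whose leaves are assumptions of the form $\cdot;A$ (hypothesis formation), some of which may be discharged; commas denote multiset union. Rules: $\to_i$-int: from $\Delta;B$ derived using assumptions $[\cdot;A]$ infer $\Delta;A\to_i B$ (discharging $\cdot;A$); $\to_i$-elim: from $\Delta_1;A\to_i B$ and $\Delta_2;A$ infer $\Delta_1,\Delta_2;B$; $\vee_i$-int: from $\Delta;A_j$ infer $\Delta;A_1\vee_i A_2$; $\vee_i$-elim: from $\Delta_1;A\vee_i B$, $\Delta_2;C$ (derived from $[\cdot;A]$) and $\Delta_3;C$ (derived from $[\cdot;B]$) infer $\Delta_1,\Delta_2,\Delta_3;C$; $\to_c$-int: from $\Delta,B;\cdot$ derived from $[\cdot;A]$ infer $\Delta;A\to_c B$; $\to_c$-elim: from $\Delta_1;A\to_c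 B$, $\Delta_2;A$ and $\Delta_3;\cdot$ (derived from $[\cdot;B]$) infer $\Delta_1,\Delta_2,\Delta_3;\cdot$; $\vee_c$-int: from $\Delta,A,B;\cdot$ infer $\Delta;A\vee_c B$; $\vee_c$-elim: from $\Delta_1;A\vee_c B$, $\Delta_2;\cdot$ (derived from $[\cdot;A]$) and $\Delta_3;\cdot$ (derived from $[\cdot;B]$) infer $\Delta_1,\Delta_2,\Delta_3;\cdot$; $\neg$-int: from $\Delta;\cdot$ derived from $[\cdot;A]$ infer $\Delta;\neg A$; $\neg$-elim: from $\Delta_1;A$ and $\Delta_2;\neg A$ infer $\Delta_1,\Delta_2;\cdot$; $\wedge$-int: from $\Delta_1;A$ and $\Delta_2;B$ infer $\Delta_1,\Delta_2;A\wedge B$; $\wedge$-elim$_j$: from $\Delta;A_1\wedge A_2$ infer $\Delta;A_j$; dereliction (der): from $\Delta;A$ infer $\Delta,A;\cdot$; $W_i$: from $\Delta;\cdot$ infer $\Delta;A$; $W_c$: from $\Delta;C$ infer $\Delta,A;C$; $C_c$: from $\Delta,A,A;C$ infer $\Delta,A;C$. $\Gamma\vdash_{\mathcal{LE}_p}\Delta;\Sigma$ means there is a derivation of $\Delta;\Sigma$ whose undischarged assumptions belong to $\Gamma$.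
   Formalization: The listed LE_p rules lack rules for p_c and ⊥, so the claim fails (Γ={⊥}, Σ=p_i); three are added: from Δ,p_i;· infer Δ;p_c; from Δ1;p_c and Δ2;· (derived from [·;p_i]) infer Δ1,Δ2;·; from Δ;⊥ infer Δ;·. *)

(* Defs.v *)
From HB Require Import structures.
From mathcomp Require Import all_boot finmap multiset.

Set Implicit Arguments.
Unset Strict Implicit.
Unset Printing Implicit Defensive.

Local Open Scope mset_scope.
Local Open Scope fset_scope.

(* Each atom name p yields two atoms, [AtomI p] (p_i) and [AtomC p] (p_c). *)
Inductive formula : Type :=
| AtomI of nat
| AtomC of nat
| Bot
| Neg of formula
| And of formula & formula
| ImpI of formula & formula
| OrI of formula & formula
| ImpC of formula & formula
| OrC of formula & formula.

Fixpoint formula_encode (A : formula) : GenTree.tree nat :=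
  match A with
  | AtomI p => GenTree.Node 0 [:: GenTree.Leaf p]
  | AtomC p => GenTree.Node 1 [:: GenTree.Leaf p]
  | Bot => GenTree.Node 2 [::]
  | Neg A => GenTree.Node 3 [:: formula_encode A]
  | And A B => GenTree.Node 4 [:: formula_encode A; formula_encode B]
  | ImpI A B => GenTree.Node 5 [:: formula_encode A; formula_encode B]
  | OrI A B => GenTree.Node 6 [:: formula_encode A; formula_encode B]
  | ImpC A B => GenTree.Node 7 [:: formula_encode A; formula_encode B]
  | OrC A B => GenTree.Node 8 [:: formula_encode A; formula_encode B]
  end.

Fixpoint formula_decode (t : GenTree.tree nat) : formula :=
  match t with
  | GenTree.Node 0 [:: GenTree.Leaf p] => AtomI p
  | GenTree.Node 1 [:: GenTree.Leaf p] => AtomC p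
  | GenTree.Node 3 [:: t] => Neg (formula_decode t)
  | GenTree.Node 4 [:: t; u] => And (formula_decode t) (formula_decode u)
  | GenTree.Node 5 [:: t; u] => ImpI (formula_decode t) (formula_decode u)
  | GenTree.Node 6 [:: t; u] => OrI (formula_decode t) (formula_decode u)
  | GenTree.Node 7 [:: t; u] => ImpC (formula_decode t) (formula_decode u)
  | GenTree.Node 8 [:: t; u] => OrC (formula_decode t) (formula_decode u)
  | _ => Bot
  end.

Lemma formula_encodeK : cancel formula_encode formula_decode.
Proof. by elim=> //= [A ->|A -> B ->|A -> B ->|A -> B ->|A -> B ->|A -> B ->]. Qed.

HB.instance Definition _ := Countable.copy formula (can_type formula_encodeK).

Definition neg_mset (D : {mset formula}) : {mset formula} :=
  seq_mset [seq Neg A | A <- D].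

(* [NE G A]: A is derivable with all undischarged assumptions in G.  A premise
   over [A |` G] is a subderivation in which any number of occurrences
   (possibly none) of the assumption A may be discharged. *)
Inductive NE : {fset formula} -> formula -> Prop :=
| NE_ax G A : A \in G -> NE G A
| NE_impI_int G A B : NE (A |` G) B -> NE G (ImpI A B)
| NE_impI_elim G A B : NE G (ImpI A B) -> NE G A -> NE G B
| NE_orI_int1 G A B : NE G A -> NE G (OrI A B)
| NE_orI_int2 G A B : NE G B -> NE G (OrI A B)
| NE_orI_elim G A B C :
    NE G (OrI A B) -> NE (A |` G) C -> NE (B |` G) C -> NE G C
| NE_impC_int G A B : NE (A |` (Neg B |` G)) Bot -> NE G (ImpC A B)
| NE_impC_elim G A B : NE G (ImpC A B) -> NE G A -> NE G (Neg B) -> NE G Bot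
| NE_orC_int G A B : NE (Neg A |` (Neg B |` G)) Bot -> NE G (OrC A B)
| NE_orC_elim G A B :
    NE G (OrC A B) -> NE G (Neg A) -> NE G (Neg B) -> NE G Bot
| NE_atomC_int G p : NE (Neg (AtomI p) |` G) Bot -> NE G (AtomC p)
| NE_atomC_elim G p : NE G (AtomC p) -> NE G (Neg (AtomI p)) -> NE G Bot
| NE_and_int G A B : NE G A -> NE G B -> NE G (And A B)
| NE_and_elim1 G A B : NE G (And A B) -> NE G A
| NE_and_elim2 G A B : NE G (And A B) -> NE G B
| NE_neg_int G A : NE (A |` G) Bot -> NE G (Neg A)
| NE_neg_elim G A : NE G A -> NE G (Neg A) -> NE G Bot
| NE_bot_elim G A : NE G Bot -> NE G A.

(* A stoup with a context: [(D, Some A)] is D;A and [(D, None)] is D;. with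
   empty stoup. *)
Definition stpc : Type := ({mset formula} * option formula)%type.

Definition hyp (A : formula) : stpc := (mset0, Some A).

(* [LE G D S]: the stp-c (D, S) is derivable with all undischarged assumptions
   in G; discharge is as in [NE].  Since W_i can introduce Bot in the stoup, the
   restriction of [LE_Wc] and [LE_Cc] to a nonempty stoup is inessential in the
   presence of [LE_bot_elim].

   [LE_atomC_int], [LE_atomC_elim] and [LE_bot_elim] are the stoup versions of
   the rules for p_c and Bot of [NE].  The other rules treat p_c and Bot as
   inert atoms: without these three, .;p_i is not derivable from .;Bot, nor
   .;. from .;p_c and .;(Neg p_i), although [NE] has the corresponding
   derivations. *)
Inductive LE : {fset stpc} -> {mset formula} -> option formula -> Prop :=
| LE_hyp G A : hyp A \in G -> LE G mset0 (Some A)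
| LE_impI_int G D A B : LE (hyp A |` G) D (Some B) -> LE G D (Some (ImpI A B))
| LE_impI_elim G D1 D2 A B :
    LE G D1 (Some (ImpI A B)) -> LE G D2 (Some A) -> LE G (D1 `+` D2) (Some B)
| LE_orI_int1 G D A B : LE G D (Some A) -> LE G D (Some (OrI A B))
| LE_orI_int2 G D A B : LE G D (Some B) -> LE G D (Some (OrI A B))
| LE_orI_elim G D1 D2 D3 A B C :
    LE G D1 (Some (OrI A B)) ->
    LE (hyp A |` G) D2 (Some C) -> LE (hyp B |` G) D3 (Some C) ->
    LE G (D1 `+` D2 `+` D3) (Some C)
| LE_impC_int G D A B : LE (hyp A |` G) (B +` D) None -> LE G D (Some (ImpC A B))
| LE_impC_elim G D1 D2 D3 A B :
    LE G D1 (Some (ImpC A B)) -> LE G D2 (Some A) -> LE (hyp B |` G) D3 None ->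
    LE G (D1 `+` D2 `+` D3) None
| LE_orC_int G D A B : LE G (A +` (B +` D)) None -> LE G D (Some (OrC A B))
| LE_orC_elim G D1 D2 D3 A B :
    LE G D1 (Some (OrC A B)) ->
    LE (hyp A |` G) D2 None -> LE (hyp B |` G) D3 None ->
    LE G (D1 `+` D2 `+` D3) None
| LE_atomC_int G D p : LE G (AtomI p +` D) None -> LE G D (Some (AtomC p))
| LE_atomC_elim G D1 D2 p :
    LE G D1 (Some (AtomC p)) -> LE (hyp (AtomI p) |` G) D2 None ->
    LE G (D1 `+` D2) None
| LE_bot_elim G D : LE G D (Some Bot) -> LE G D None
| LE_neg_int G D A : LE (hyp A |` G) D None -> LE G D (Some (Neg A))
| LE_neg_elim G D1 D2 A :
    LE G D1 (Some A) -> LE G D2 (Some (Neg A)) -> LE G (D1 `+` D2) None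
| LE_and_int G D1 D2 A B :
    LE G D1 (Some A) -> LE G D2 (Some B) -> LE G (D1 `+` D2) (Some (And A B))
| LE_and_elim1 G D A B : LE G D (Some (And A B)) -> LE G D (Some A)
| LE_and_elim2 G D A B : LE G D (Some (And A B)) -> LE G D (Some B)
| LE_der G D A : LE G D (Some A) -> LE G (A +` D) None
| LE_Wi G D A : LE G D None -> LE G D (Some A)
| LE_Wc G D A C : LE G D (Some C) -> LE G (A +` D) (Some C)
| LE_Cc G D A C : LE G (A +` (A +` D)) (Some C) -> LE G (A +` D) (Some C).

(* Main.v *)
Require Import Defs.
From mathcomp Require Import all_boot finmap multiset.

Set Implicit Arguments.
Unset Strict Implicit.
Unset Printing Implicit Defensive.

Local Open Scope mset_scope.
Local Open Scope fset_scope.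

(** Reading a context formula B as the NE assumption Neg B turns every rule of
    LE into a derivable rule of NE.  Conversely, an NE assumption Neg B with B
    in the context is recovered by dereliction on B followed by [LE_neg_int];
    since contexts can be weakened and contracted, only their support matters,
    and the shared-context premises of NE can be fed to the multiplicative rules of
    LE. *)

(** This lets a derivation of [Neg A] be reused after A has been added as a hypothesis. The
    induction keeps [G'] general because discharging rules enlarge both sets. *)
Lemma LE_weaken G G' D S : LE G D S -> G `<=` G' -> LE G' D S.
Proof.
move=> d; elim: d G' => {G D S} [G A AG|G D A B _ IH|G D1 D2 A B _ IH1 _ IH2
  |G D A B _ IH|G D A B _ IH|G D1 D2 D3 A B C _ IH1 _ IH2 _ IH3|G D A B _ IH
  |G D1 D2 D3 A B _ IH1 _ IH2 _ IH3|G D A B _ IH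
  |G D1 D2 D3 A B _ IH1 _ IH2 _ IH3|G D p _ IH|G D1 D2 p _ IH1 _ IH2|G D _ IH
  |G D A _ IH|G D1 D2 A _ IH1 _ IH2|G D1 D2 A B _ IH1 _ IH2|G D A B _ IH
  |G D A B _ IH|G D A _ IH|G D A _ IH|G D A C _ IH|G D A C _ IH] G' sGG'.
- by apply: LE_hyp; apply: (fsubsetP sGG').
- by apply: LE_impI_int; apply: IH; rewrite fsetUS.
- by apply: LE_impI_elim (IH1 _ sGG') (IH2 _ sGG').
- by apply: LE_orI_int1; apply: IH.
- by apply: LE_orI_int2; apply: IH.
- by apply: LE_orI_elim (IH1 _ sGG') _ _; [apply: IH2|apply: IH3];
    rewrite fsetUS.
- by apply: LE_impC_int; apply: IH; rewrite fsetUS.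
- by apply: LE_impC_elim (IH1 _ sGG') (IH2 _ sGG') _; apply: IH3;
    rewrite fsetUS.
- by apply: LE_orC_int; apply: IH.
- by apply: LE_orC_elim (IH1 _ sGG') _ _; [apply: IH2|apply: IH3];
    rewrite fsetUS.
- by apply: LE_atomC_int; apply: IH.
- by apply: LE_atomC_elim (IH1 _ sGG') _; apply: IH2; rewrite fsetUS.
- by apply: LE_bot_elim (IH _ sGG').
- by apply: LE_neg_int; apply: IH; rewrite fsetUS.
- by apply: LE_neg_elim (IH1 _ sGG') (IH2 _ sGG').
- by apply: LE_and_int (IH1 _ sGG') (IH2 _ sGG').
- by apply: LE_and_elim1 (IH _ sGG').
- by apply: LE_and_elim2 (IH _ sGG').
- by apply: LE_der (IH _ sGG').
- by apply: LE_Wi (IH _ sGG').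
- by apply: LE_Wc (IH _ sGG').
- by apply: LE_Cc (IH _ sGG').
Qed.

Lemma seq_mset_nil (K : choiceType) : seq_mset [::] = mset0 :> {mset K}.
Proof. by apply/msetP => x; rewrite mset_seqE mset0E. Qed.

Lemma LE_ctx_weaken G D E C : LE G D (Some C) -> LE G (E `+` D) (Some C).
Proof.
move=> d; rewrite -[E]seq_mset_id; elim: (E : seq _) => [|A s IH].
  by rewrite seq_mset_nil mset0D.
by rewrite mset_cons -msetDA; apply: LE_Wc.
Qed.

Lemma LE_ctx_contract G (D E : {mset formula}) C :
  {subset E <= D} -> LE G (E `+` D) (Some C) -> LE G D (Some C).
Proof.
move=> sED; have {sED}: all [in D] E by apply/allP.
rewrite -{2}[E]seq_mset_id; elim: (E : seq _) => [|A s IH] /=.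
  by rewrite seq_mset_nil mset0D.
move=> /andP[AD sD]; rewrite mset_cons -msetDA => d; apply: IH => //.
(* Since A lies in D, a copy of A is split off D; the extra A is contracted against it, and D is
   then reassembled. *)
rewrite -(msetB1K AD) msetDCA; apply: LE_Cc.
by rewrite (msetDCA [mset A] (seq_mset s)) msetB1K.
Qed.

(** Multiplicities are irrelevant: all of [D'] is first added to D by weakening, then the copies
    coming from D are absorbed by contraction. *)
Lemma LE_ctx_sub G (D D' : {mset formula}) C :
  LE G D (Some C) -> {subset D <= D'} -> LE G D' (Some C).
Proof.
move=> d sDD'; apply: LE_ctx_contract sDD' _; rewrite msetDC.
exact: LE_ctx_weaken.
Qed.

(* The structural rules of LE need a nonempty stoup; [LE_Wi] and [LE_bot_elim]
   make the empty stoup equivalent to Bot. *)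
Lemma LE_botE G D : LE G D None <-> LE G D (Some Bot).
Proof. by split; [apply: LE_Wi|apply: LE_bot_elim]. Qed.

Lemma LE_ctx_subN G (D D' : {mset formula}) : LE G D None -> {subset D <= D'} -> LE G D' None.
Proof. by rewrite !LE_botE; apply: LE_ctx_sub. Qed.

(** Asking only that H contain the required assumptions makes the induction work: H stays fixed
    while a rule splits D among its premises, and it grows when a premise discharges. *)
Lemma NE_of_LE G (D : {mset formula}) S H : LE G D S ->
  (forall A, hyp A \in G -> A \in H) -> {in D, forall B, Neg B \in H} ->
  NE H (odflt Bot S).
Proof.
have hypU A (K : {fset stpc}) L : (forall B, hyp B \in K -> B \in L) ->
    forall B, hyp B \in hyp A |` K -> B \in A |` L.
  by move=> KL B; rewrite !inE => /orP[/eqP[->]|/KL->];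
    rewrite ?eqxx ?orbT.
have negU A (E : {mset formula}) L : {in E, forall B, Neg B \in L} ->
    {in E, forall B, Neg B \in A |` L}.
  by move=> EL B /EL BL; rewrite !inE BL orbT.
(* Where a classical rule of [LE] removes A from the context, the matching rule of [NE] discharges
   [Neg A]. *)
have negD A (E : {mset formula}) L : {in E, forall B, Neg B \in L} ->
    {in A +` E, forall B, Neg B \in Neg A |` L}.
  move=> EL B; rewrite in_mset1D => /orP[/eqP->|/EL BL]; first exact: fset1U1.
  by rewrite !inE BL orbT.
have hypUr A (K : {fset stpc}) L : (forall B, hyp B \in K -> B \in L) ->
    forall B, hyp B \in K -> B \in A |` L.
  by move=> KL B /KL BL; rewrite !inE BL orbT.
have inDl (D1 D2 : {mset formula}) L : {in D1 `+` D2, forall B, Neg B \in L} ->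
    {in D1, forall B, Neg B \in L}.
  by move=> DL B BD; apply: DL; rewrite in_msetD BD.
have inDr (D1 D2 : {mset formula}) L : {in D1 `+` D2, forall B, Neg B \in L} ->
    {in D2, forall B, Neg B \in L}.
  by move=> DL B BD; apply: DL; rewrite in_msetD BD orbT.
move=> d; elim: d H => {G D S} [G A AG|G D A B _ IH|G D1 D2 A B _ IH1 _ IH2
  |G D A B _ IH|G D A B _ IH|G D1 D2 D3 A B C _ IH1 _ IH2 _ IH3|G D A B _ IH
  |G D1 D2 D3 A B _ IH1 _ IH2 _ IH3|G D A B _ IH
  |G D1 D2 D3 A B _ IH1 _ IH2 _ IH3|G D p _ IH|G D1 D2 p _ IH1 _ IH2|G D _ IH
  |G D A _ IH|G D1 D2 A _ IH1 _ IH2|G D1 D2 A B _ IH1 _ IH2|G D A B _ IH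
  |G D A B _ IH|G D A _ IH|G D A _ IH|G D A C _ IH|G D A C _ IH] H /=.
- by move=> GH _; apply: NE_ax; apply: GH.
- by move=> GH DH; apply: NE_impI_int; apply: IH; [apply: hypU|apply: negU].
- by move=> GH DH; apply: (@NE_impI_elim _ A); [apply: IH1|apply: IH2]; eauto.
- by move=> GH DH; apply: NE_orI_int1; apply: IH.
- by move=> GH DH; apply: NE_orI_int2; apply: IH.
- by move=> GH DH; apply: (@NE_orI_elim _ A B);
    [apply: IH1|apply: IH2|apply: IH3]; eauto.
- move=> GH DH; apply: NE_impC_int; apply: IH; first by apply/hypU/hypUr.
  exact/negU/negD.
- move=> GH DH; apply: (@NE_impC_elim _ A B); [apply: IH1|apply: IH2|]; eauto.
  (* The premise refuting the hypothesis B becomes a proof of [Neg B], the form that [NE]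
     expects. *)
  by apply: NE_neg_int; apply: IH3; eauto.
- by move=> GH DH; apply: NE_orC_int; apply: IH;
    [apply/hypUr/hypUr|apply/negD/negD].
- move=> GH DH; apply: (@NE_orC_elim _ A B); first by apply: IH1; eauto.
    by apply: NE_neg_int; apply: IH2; eauto.
  by apply: NE_neg_int; apply: IH3; eauto.
- by move=> GH DH; apply: NE_atomC_int; apply: IH; [apply/hypUr|apply/negD].
- move=> GH DH; apply: (@NE_atomC_elim _ p); first by apply: IH1; eauto.
  by apply: NE_neg_int; apply: IH2; eauto.
- exact: IH.
- by move=> GH DH; apply: NE_neg_int; apply: IH; [apply: hypU|apply: negU].
- by move=> GH DH; apply: (@NE_neg_elim _ A); [apply: IH1|apply: IH2]; eauto.
- by move=> GH DH; apply: NE_and_int; [apply: IH1|apply: IH2]; eauto.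
- by move=> GH DH; apply: (@NE_and_elim1 _ A B); apply: IH.
- by move=> GH DH; apply: (@NE_and_elim2 _ A B); apply: IH.
(* Dereliction puts A into the context, so [Neg A] is among the assumptions and contradicts the
   derived A. *)
- move=> GH DH; apply: (@NE_neg_elim _ A); first by apply: IH; eauto.
  by apply: NE_ax; apply: DH; rewrite mset1D1.
- by move=> GH DH; apply: NE_bot_elim; apply: IH.
- by move=> GH DH; apply: IH; eauto.
- by move=> GH DH; apply: IH => // B; rewrite in_mset1D => /orP[/eqP->|/DH//];
    apply: DH; rewrite mset1D1.
Qed.

(** An assumption of the form [Neg B] may be represented by a hypothesis or by B in the context. The
    choice is made at its discharge, according to what the matching [LE] rule removes. *)
Lemma LE_of_NE G (D : {mset formula}) H C : NE H C ->
  {in H, forall B, hyp B \in G \/ exists2 B', B = Neg B' & B' \in D} ->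
  LE G D (Some C).
Proof.
pose covers (L : {fset formula}) (K : {fset stpc}) (E : {mset formula}) :=
  {in L, forall B, hyp B \in K \/ exists2 B', B = Neg B' & B' \in E}.
have covU A L K E : covers L K E -> covers (A |` L) (hyp A |` K) E.
  move=> LK B; rewrite !inE => /orP[/eqP->|/LK[->|?]]; rewrite ?eqxx ?orbT;
  by [left|right].
have covN A L K E : covers L K E -> covers (Neg A |` L) K (A +` E).
  move=> LK B; rewrite !inE => /orP[/eqP->|/LK[BK|[B' -> B'E]]].
  - by right; exists A => //; rewrite mset1D1.
  - by left.
  - by right; exists B' => //; rewrite mset1Dr.
(* Converse of the passage from a refutation to a negation: [Neg A] meets the hypothesis A, giving
   the empty-stoup premise of the classical eliminations. *)
have negE K (E E' : {mset formula}) A : LE K E (Some (Neg A)) -> {subset E <= E'} ->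
    LE (hyp A |` K) E' None.
  move=> d sE; apply: LE_ctx_subN sE; rewrite -[E]mset0D.
  apply: (@LE_neg_elim _ _ _ A); last exact: LE_weaken d (fsubsetU1 _ _).
  by apply: LE_hyp; rewrite fset1U1.
(* Every premise is derived over the same D, so the multiplicative rules yield two or three copies
   of D, which collapse to one. *)
have sub2 (E : {mset formula}) : {subset E `+` E <= E}.
  by move=> B; rewrite in_msetD orbb.
have sub3 (E : {mset formula}) : {subset E `+` E `+` E <= E}.
  by move=> B; rewrite !in_msetD !orbb.
move=> d; elim: d G D => {H C} [H A AH|H A B _ IH|H A B _ IH1 _ IH2|H A B _ IH
  |H A B _ IH|H A B C _ IH1 _ IH2 _ IH3|H A B _ IH|H A B _ IH1 _ IH2 _ IH3
  |H A B _ IH|H A B _ IH1 _ IH2 _ IH3|H p _ IH|H p _ IH1 _ IH2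
  |H A B _ IH1 _ IH2|H A B _ IH|H A B _ IH|H A _ IH|H A _ IH1 _ IH2|H A _ IH]
  G D.
- move=> /(_ _ AH)[AG|[B -> BD]].
    by rewrite -[D]msetD0; apply/LE_ctx_weaken/LE_hyp.
  apply: (@LE_ctx_sub _ (B +` mset0)); last first.
    by move=> X; rewrite in_mset1D in_mset0 orbF => /eqP->.
  by apply: LE_neg_int; apply: LE_der; apply: LE_hyp; rewrite fset1U1.
- by move=> cov; apply: LE_impI_int; apply/IH/covU.
- move=> cov; apply: LE_ctx_sub (sub2 D).
  exact: LE_impI_elim (IH1 _ _ cov) (IH2 _ _ cov).
- by move=> cov; apply: LE_orI_int1; apply: IH.
- by move=> cov; apply: LE_orI_int2; apply: IH.
- move=> cov; apply: LE_ctx_sub (sub3 D).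
  by apply: LE_orI_elim (IH1 _ _ cov) _ _; [apply/IH2/covU|apply/IH3/covU].
- by move=> cov; apply: LE_impC_int; apply/LE_botE/IH/covU/covN.
- move=> cov; apply: LE_Wi; apply: LE_ctx_subN (sub3 D).
  apply: LE_impC_elim (IH1 _ _ cov) (IH2 _ _ cov) _.
  exact: negE (IH3 _ _ cov) _.
- by move=> cov; apply: LE_orC_int; apply/LE_botE/IH/covN/covN.
- move=> cov; apply: LE_Wi; apply: LE_ctx_subN (sub3 D).
  by apply: LE_orC_elim (IH1 _ _ cov) (negE _ _ _ _ (IH2 _ _ cov) _)
    (negE _ _ _ _ (IH3 _ _ cov) _).
- by move=> cov; apply: LE_atomC_int; apply/LE_botE/IH/covN.
- move=> cov; apply: LE_Wi; apply: LE_ctx_subN (sub2 D).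
  by apply: LE_atomC_elim (IH1 _ _ cov) (negE _ _ _ _ (IH2 _ _ cov) _).
- move=> cov; apply: LE_ctx_sub (sub2 D).
  exact: LE_and_int (IH1 _ _ cov) (IH2 _ _ cov).
- by move=> cov; apply: LE_and_elim1 (IH _ _ cov).
- by move=> cov; apply: LE_and_elim2 (IH _ _ cov).
- by move=> cov; apply: LE_neg_int; apply/LE_botE/IH/covU.
- move=> cov; apply: LE_Wi; apply: LE_ctx_subN (sub2 D).
  exact: LE_neg_elim (IH1 _ _ cov) (IH2 _ _ cov).
- by move=> cov; apply: LE_Wi; apply/LE_botE/IH.
Qed.

Lemma mem_neg_mset (D : {mset formula}) B :
  reflect (exists2 B', B = Neg B' & B' \in D) (B \in neg_mset D).
Proof.
rewrite (perm_mem (perm_eq_seq_mset _)).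
by apply: (iffP mapP) => -[B' ? ?]; exists B'.
Qed.

Theorem theorem2 (n : nat) (A : 'I_n.+1 -> formula)
    (D : {mset formula}) (S : option formula) :
  LE [fset hyp (A i) | i in 'I_n.+1] D S <->
  NE ([fset A i | i in 'I_n.+1] `|` [fset B in neg_mset D]) (odflt Bot S).
Proof.
split=> d.
  apply: NE_of_LE d _ _ => B.
    by move=> /imfsetP[i _ [->]]; rewrite in_fsetU in_imfset.
  by move=> BD; rewrite in_fsetU inE /=; apply/orP; right;
    apply/mem_neg_mset; exists B.
(* The translation from [NE] always fills the stoup; when S is empty, the stoup [Bot] is emptied
   afterwards. *)
suff: LE [fset hyp (A i) | i in 'I_n.+1] D (Some (odflt Bot S)).
  by case: (S) => //= /LE_botE.
apply: LE_of_NE d _ => B; rewrite in_fsetU => /orP[/imfsetP[i _ ->]|].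
  by left; apply/imfsetP; exists i.
by rewrite inE /= => /mem_neg_mset; right.
Qed.
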